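(* Let $C$ be a closed convex set with nonempty interior of the coordinate-wise ordered Euclidean space $\mathbb{R}^m$. Then the following assertions are equivalent: (i) the set $C$ is a sublattice; (ii) the projection $P_C$ is isotone, i.e. $x\le y$ implies $P_Cx\le P_Cy$; (iii) $$C=\bigcap_{i\in\mathbb{N}}H_-(u_i,a_i),$$ where each hyperplane $H(u_i,a_i)$ is tangent to $C$ and the normals $u_i$ are nonzero vectors $u_i=(u_i^1,\dots,u_i^m)$ with the property $u_i^ku_i^l\le 0$ whenever $k\ne l$, $i\in\mathbb{N}$.
   Context: The coordinate-wise order on $\mathbb{R}^m$ is $x\le y\Leftrightarrow x^i\le y^i$ for $i=1,\dots,m$. A set $M\subset\mathbb{R}^m$ is a sublattice if $x,y\in M$ implies that the coordinate-wise minimum $x\wedge y$ and the coordinate-wise maximum $x\vee y$ belong to $M$. For a nonempty closed convex set $D$, $P_D x$ denotes the unique point of $D$ nearest to $x$ in the Euclidean norm. With $\langle\cdot,\cdot\rangle$ the standard scalar product, for $u\neq 0$ and $a\in\mathbb{R}^m$: $H(u,a)=\{x\in\mathbb{R}^m:\langle u,x\rangle=\langle u,a\rangle\}$ and $H_-(u,a)=\{x\in\mathbb{R}^m:\langle u,x\rangle\le\langle u,a\rangle\}$. ''Tangent to $C$'' means tangent to $C$ at some point of the boundary of $C$.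
   Formalization: In (iii) the half-spaces are indexed by a subset of ℕ, possibly empty, instead of all of ℕ: C = R^m satisfies (i) and (ii) but has no boundary and hence no tangent hyperplane; for C ≠ R^m the two forms agree. *)

(* Defs.v *)
(* R^m is the row-vector space 'rV[R]_m over R : realType (MathComp-Analysis). *)
From HB Require Import structures.
From mathcomp Require Export all_boot all_order all_algebra.
From mathcomp Require Export all_classical all_reals all_analysis.
Export Order.TTheory GRing.Theory Num.Theory.
Export numFieldNormedType.Exports.

Set Implicit Arguments.
Unset Strict Implicit.
Unset Printing Implicit Defensive.

Local Open Scope classical_set_scope.
Local Open Scope ring_scope.

Section CoordinatewiseOrder.
Variables (R : realType) (m : nat).
Implicit Types (x y : 'rV[R]_m) (M : set 'rV[R]_m).

Definition cw_le x y : Prop := forall i : 'I_m, x 0 i <= y 0 i.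

Definition cw_min x y : 'rV[R]_m := map2_mx Num.min x y.

Definition cw_max x y : 'rV[R]_m := map2_mx Num.max x y.

Definition sublattice M : Prop :=
  forall x y, M x -> M y -> M (cw_min x y) /\ M (cw_max x y).

Definition isotone (f : 'rV[R]_m -> 'rV[R]_m) : Prop :=
  forall x y, cw_le x y -> cw_le (f x) (f y).

End CoordinatewiseOrder.

Section Euclidean.
Variables (R : realType) (m : nat).
Implicit Types (x y u a : 'rV[R]_m) (C D H : set 'rV[R]_m).

Definition dot x y : R := \sum_(i < m) x 0 i * y 0 i.

(* The library norm `|x| on row vectors is the sup norm. It induces the usual
   topology of R^m, but it is not the norm that defines nearest points. *)
Definition enorm x : R := Num.sqrt (dot x x).

Definition nearest_point D x p : Prop :=
  D p /\ forall q, D q -> enorm (x - p) <= enorm (x - q).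

(* If D is nonempty, closed and convex, there is exactly one nearest point;
   the default value 0 is used only when there is none. *)
Definition proj D x : 'rV[R]_m := xget 0 [set p | nearest_point D x p].

Definition hyperplane u a : set 'rV[R]_m := [set x | dot u x = dot u a].

Definition halfspace u a : set 'rV[R]_m := [set x | dot u x <= dot u a].

Definition boundary C : set 'rV[R]_m := closure C `\` interior C.

Definition supporting_at C H x : Prop :=
  C x /\ exists u, [/\ u != 0, H = hyperplane u x & C `<=` halfspace u x].

(* Tangency in the sense of Rockafellar (Convex Analysis): H is the only
   supporting hyperplane of C at x. *)
Definition tangent_at C H x : Prop :=
  supporting_at C H x /\ forall H', supporting_at C H' x -> H' = H.

Definition tangent C H : Prop := exists x, boundary C x /\ tangent_at C H x.

(* C is a countable intersection of half-spaces whose hyperplanes are tangent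
   to C and whose normals have coordinates of pairwise nonpositive products.
   The index set I is a subset of nat so that the empty intersection is
   available: it is needed for C = setT, which has no tangent hyperplane. For
   C != setT, I is nonempty and repeating members gives a family indexed by all
   of nat. *)
Definition tangent_representation C : Prop :=
  exists (I : set nat) (u a : nat -> 'rV[R]_m),
    C = \bigcap_(i in I) halfspace (u i) (a i) /\
    forall i, I i ->
      [/\ u i != 0,
          tangent C (hyperplane (u i) (a i)) &
          forall k l : 'I_m, k != l -> u i 0 k * u i 0 l <= 0].

End Euclidean.

(* Main.v *)
(* For (i) => (iii) no theorem on differentiability of convex functions is used.
   If y is interior to C and x is a point of the complement of int C nearest to
   y, then the ball centered at y through x lies in C and touches the boundary
   at x, so the hyperplane through x normal to x - y is the only supporting
   hyperplane of C at x. Inside this ball, x can be moved in the two opposite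
   directions (x - y)^l e_k - (x - y)^k e_l, up to a second order correction;
   the maximum or the minimum of the two resulting points leaves the half-space
   unless (x - y)^k (x - y)^l <= 0. Letting y range over the rational interior
   points gives countably many half-spaces. If z is not in C, one of them omits
   z: take y close to the point where a segment from an interior point to z
   leaves int C. *)
From mathcomp Require Import ring lra.
Require Import Defs.

Set Implicit Arguments.
Unset Strict Implicit.
Unset Printing Implicit Defensive.

Local Open Scope classical_set_scope.
Local Open Scope ring_scope.

(** * Euclidean scalar product and norm *)

Section Dot.
Variables (R : realType) (m : nat).
Implicit Types (x y z u v w : 'rV[R]_m) (a : R).

Lemma dotC x y : dot x y = dot y x.
Proof. by apply: eq_bigr => i _; rewrite mulrC. Qed.

Lemma dotDl x y z : dot (x + y) z = dot x z + dot y z.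
Proof.
by rewrite /dot -big_split; apply: eq_bigr => i _; rewrite !mxE mulrDl.
Qed.

Lemma dotZl a x y : dot (a *: x) y = a * dot x y.
Proof.
by rewrite /dot mulr_sumr; apply: eq_bigr => i _; rewrite !mxE mulrA.
Qed.

Lemma dotNl x y : dot (- x) y = - dot x y.
Proof. by rewrite -scaleN1r dotZl mulN1r. Qed.

Lemma dotDr x y z : dot z (x + y) = dot z x + dot z y.
Proof. by rewrite !(dotC z) dotDl. Qed.

Lemma dotZr a x y : dot x (a *: y) = a * dot x y.
Proof. by rewrite !(dotC x) dotZl. Qed.

Lemma dotNr x y : dot x (- y) = - dot x y.
Proof. by rewrite !(dotC x) dotNl. Qed.

Lemma dot0l x : dot 0 x = 0.
Proof. by rewrite -(scale0r x) dotZl mul0r. Qed.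

Lemma dot0r x : dot x 0 = 0.
Proof. by rewrite dotC dot0l. Qed.

Lemma dot_delta x (k : 'I_m) : dot x (delta_mx 0 k) = x 0 k.
Proof.
rewrite /dot (bigD1 k)//= big1 => [|i ik].
  by rewrite mxE !eqxx mulr1 addr0.
by rewrite mxE (negbTE ik) mulr0.
Qed.

Definition dotE := (dotDl, dotDr, dotNl, dotNr, dotZl, dotZr).

Lemma dot_ge0 x : 0 <= dot x x.
Proof. by apply: sumr_ge0 => i _; rewrite -expr2 sqr_ge0. Qed.

Lemma dot_eq0 x : (dot x x == 0) = (x == 0).
Proof.
apply/eqP/eqP => [|->]; last by rewrite dot0l.
move=> /psumr_eq0P x0; apply/rowP => i; apply/eqP.
rewrite mxE -sqrf_eq0 expr2 x0 // => j _; by rewrite -expr2 sqr_ge0.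
Qed.

Lemma dot_gt0 x : (0 < dot x x) = (x != 0).
Proof. by rewrite lt_def dot_ge0 andbT dot_eq0. Qed.

Lemma sqr_enorm x : enorm x ^+ 2 = dot x x.
Proof. by rewrite sqr_sqrtr ?dot_ge0. Qed.

Lemma enorm_ge0 x : 0 <= enorm x.
Proof. exact: sqrtr_ge0. Qed.

Lemma le_enorm x y : (enorm x <= enorm y) = (dot x x <= dot y y).
Proof. by rewrite ler_sqrt ?dot_ge0. Qed.

Lemma lt_enorm x y : (enorm x < enorm y) = (dot x x < dot y y).
Proof. by rewrite !ltNge le_enorm. Qed.

Lemma enorm_gt0 x : (0 < enorm x) = (x != 0).
Proof. by rewrite sqrtr_gt0 dot_gt0. Qed.

Lemma enormN x : enorm (- x) = enorm x.
Proof. by rewrite /enorm dotNl dotNr opprK. Qed.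

Lemma enormBC x y : enorm (x - y) = enorm (y - x).
Proof. by rewrite -enormN opprB. Qed.

Lemma enormZ a x : enorm (a *: x) = `|a| * enorm x.
Proof.
by rewrite /enorm dotZl dotZr mulrA -expr2 sqrtrM ?sqr_ge0// sqrtr_sqr.
Qed.

Lemma enorm0 : enorm (0 : 'rV[R]_m) = 0.
Proof. by rewrite /enorm dot0l sqrtr0. Qed.

(** Cauchy-Schwarz, from the nonnegative square of [enorm y *: x - enorm x *: y]. *)
Lemma dot_le_enorm x y : dot x y <= enorm x * enorm y.
Proof.
have [->|x0] := eqVneq x 0; first by rewrite enorm0 dot0l mul0r.
have [->|y0] := eqVneq y 0; first by rewrite enorm0 dot0r mulr0.
have := dot_ge0 (enorm y *: x - enorm x *: y).
rewrite !dotE (dotC y x) -!sqr_enorm.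
move: x0 y0; rewrite -!enorm_gt0; set a := enorm x; set b := enorm y.
move=> a0 b0 h; have ab := mulr_gt0 a0 b0.
by rewrite -(ler_pM2l ab); nra.
Qed.

Lemma ler_enormD x y : enorm (x + y) <= enorm x + enorm y.
Proof.
rewrite -[leRHS]ger0_norm ?addr_ge0 ?enorm_ge0// -sqrtr_sqr.
rewrite ler_sqrt ?sqr_ge0//.
have := dot_le_enorm x y; rewrite !dotE (dotC y x) sqrrD !sqr_enorm; lra.
Qed.

Lemma norm_le_enorm x : `|x| <= enorm x.
Proof.
rewrite [leLHS]/Num.norm /= mx_normrE; apply/bigmax_leP; split.
  exact: enorm_ge0.
move=> [i j] _ /=; rewrite ord1 -sqrtr_sqr ler_sqrt ?dot_ge0//.
rewrite /dot (bigD1 j)//= expr2 lerDl sumr_ge0// => k _.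
by rewrite -expr2 sqr_ge0.
Qed.

Lemma continuous_dot (T : topologicalType) (f g : T -> 'rV[R]_m) :
  continuous f -> continuous g -> continuous (fun t => dot (f t) (g t)).
Proof.
move=> cf cg; apply: continuous_big => [|i _].
  exact: add_continuous.
move=> t; apply: (@continuousM _ _ (fun t => f t 0 i) (fun t => g t 0 i)).
  exact: (continuous_comp (cf t) (@coord_continuous _ _ _ _ _ _)).
exact: (continuous_comp (cg t) (@coord_continuous _ _ _ _ _ _)).
Qed.

Lemma continuous_enormB x : continuous (fun y => enorm (y - x)).
Proof.
move=> y; apply: (@continuous_comp _ _ _ (fun y => dot (y - x) (y - x)));
  last exact: sqrt_continuous.
apply: continuous_dot => {}y; apply: (@continuousB _ _ _ id (cst x)) => //.
all: exact: cst_continuous.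
Qed.

(** The topology comes from the sup norm; this lets later arguments use Euclidean balls. One
    direction is [norm_le_enorm], the other is continuity of [enorm]. *)
Lemma nbhs_enormP x (A : set 'rV[R]_m) :
  nbhs x A <-> exists2 e, 0 < e & forall y, enorm (y - x) < e -> A y.
Proof.
split=> [/nbhs_normP[e /= e0 xA]|[e e0 eA]].
  exists e => // y yx; apply: xA; rewrite /= -opprB normrN.
  exact: le_lt_trans (norm_le_enorm _) yx.
apply: filterS eA _.
apply: (@continuous_enormB x x [set t | t < e]).
by apply: lt_nbhsl; rewrite subrr enorm0.
Qed.

End Dot.

(** * Nearest points: existence, obtuse-angle inequality, uniqueness *)

Section NearestPoint.
Variables (R : realType) (m : nat).
Implicit Types (x y z u v w p q c : 'rV[R]_m) (a t : R) (C D : set 'rV[R]_m).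

Lemma convex_comb C x y t : convex_set C -> 0 <= t -> t <= 1 -> C x -> C y ->
  C (t *: x + (1 - t) *: y).
Proof.
move=> cC t0 t1 /mem_set Cx /mem_set Cy.
exact: set_mem (cC x y (Itv01 t0 t1) Cx Cy).
Qed.

(** Stated for closed sets so as to cover the complement of [interior C] as well. The distance to
    [x] attains its minimum on the compact set of points of [D] no farther from [x] than [d]. *)
Lemma exists_nearest_point D x : closed D -> D !=set0 ->
  exists p, nearest_point D x p.
Proof.
move=> clD [d Dd].
pose K := D `&` [set w | enorm (w - x) <= enorm (d - x)].
have Kd : K d by split => /=.
have cK : compact K.
  apply: bounded_closed_compact.
    exists (enorm (d - x) + enorm x); split; first exact: num_real.
    move=> M dM w [_ /= wd]; apply: le_trans (norm_le_enorm _) _.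
    rewrite -(subrK x w) (le_trans (ler_enormD _ _))//.
    by apply: le_trans (ltW dM); rewrite lerD2r.
  apply: closedI => //.
  apply: (@closed_comp _ _ (fun w => enorm (w - x))
    [set t | t <= enorm (d - x)]); last exact: closed_le.
  by move=> w _; exact: continuous_enormB.
have [|p /set_mem[Dp pd] pmin] := compact_EVT_min (ex_intro _ d Kd) cK
  (f := fun w => enorm (w - x)).
  by apply: continuous_subspaceT; exact: continuous_enormB.
exists p; split => // q Dq; rewrite !(enormBC x).
have [qd|qd] := leP (enorm (q - x)) (enorm (d - x)).
  by apply: pmin; apply/mem_set.
exact: le_trans pd (ltW qd).
Qed.

Lemma nearest_point_obtuse C x p c : convex_set C -> nearest_point C x p ->
  C c -> dot (x - p) (c - p) <= 0.
Proof.
move=> cC [Cp pmin] Cc; rewrite leNgt; apply/negP => a0.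
set a := dot _ _ in a0; set b := dot (c - p) (c - p).
have b0 : 0 < b.
  rewrite dot_gt0; apply: contraTneq a0 => cp.
  by rewrite /a cp dot0r ltxx.
(* [a / b] minimises the squared distance from [x] to [p + t *: (c - p)]; the cap at 1 keeps the
   point on the segment from [p] to [c]. *)
pose t := Num.min 1 (a / b).
have t0 : 0 < t by rewrite lt_min ltr01 divr_gt0.
have t1 : t <= 1 by rewrite ge_min lexx.
have tb : t * b <= a by rewrite -ler_pdivlMr// ge_min lexx orbT.
have := pmin _ (convex_comb cC (ltW t0) t1 Cc Cp).
have -> : x - (t *: c + (1 - t) *: p) = (x - p) - t *: (c - p).
  by apply/rowP => i; rewrite !mxE; ring.
rewrite le_enorm; move: tb a0; rewrite /a /b.
move: (x - p) (c - p) => v w tb a0.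
rewrite !dotE (dotC w v); nra.
Qed.

Lemma nearest_point_unique C x p q : convex_set C ->
  nearest_point C x p -> nearest_point C x q -> p = q.
Proof.
move=> cC np nq; apply/eqP; rewrite -subr_eq0 -dot_eq0 eq_le dot_ge0 andbT.
have := nearest_point_obtuse cC np nq.1.
have := nearest_point_obtuse cC nq np.1.
rewrite !dotE (dotC q p); lra.
Qed.

Lemma proj_nearest C x : closed C -> C !=set0 -> nearest_point C x (proj C x).
Proof. by move=> clC C0; apply: xgetPex; exact: exists_nearest_point. Qed.

End NearestPoint.

(** * Sublattices, isotone projections and half-spaces *)

Section Sublattice.
Variables (R : realType) (m : nat).
Implicit Types (x y z u v w p q c : 'rV[R]_m) (C : set 'rV[R]_m).

(** Only coordinates with [q < p] matter: there the exchange of the two entries changes the sum by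
    [2 (x - y) (p - q)], which is nonpositive. *)
Lemma dot_cw_min_max x y p q : cw_le x y ->
  dot (x - cw_min p q) (x - cw_min p q) + dot (y - cw_max p q) (y - cw_max p q)
  <= dot (x - p) (x - p) + dot (y - q) (y - q).
Proof.
move=> xy; rewrite /dot -!big_split; apply: ler_sum => i _; rewrite !mxE /=.
by have := xy i; case: (leP (p 0 i) (q 0 i)) => pq xyi; nra.
Qed.

Lemma sublattice_isotone_proj C : closed C -> convex_set C -> C !=set0 ->
  sublattice C -> isotone (proj C).
Proof.
move=> clC cC C0 lC x y xy.
have [Cp pmin] := proj_nearest x clC C0.
have [Cq qmin] := proj_nearest y clC C0.
set p := proj C x in Cp pmin *; set q := proj C y in Cq qmin *.
have [Cm CM] := lC _ _ Cp Cq.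
(* Since [cw_max p q] is no closer to [y] than [q], the exchange inequality makes [cw_min p q] at
   least as close to [x] as [p]. *)
have ppq : cw_min p q = p.
  apply: (@nearest_point_unique _ _ C x) => //; split => // c Cc.
  apply: le_trans (pmin c Cc).
  have := dot_cw_min_max p q xy; have := qmin _ CM.
  rewrite !le_enorm; lra.
by move=> i; rewrite -ppq !mxE ge_min lexx orbT.
Qed.

(** The sign condition puts [z] between [p] and [c] in each coordinate, so [dot (z - p) (c - p)] is
    at least [dot (z - p) (z - p)], while the obtuse-angle inequality makes it nonpositive. *)
Lemma nearest_point_fixed C z p c : convex_set C -> nearest_point C z p ->
  C c -> (forall i, 0 <= (z 0 i - p 0 i) * (c 0 i - z 0 i)) -> C z.
Proof.
move=> cC np Cc zc; suff -> : z = p by exact: np.1.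
apply/eqP; rewrite -subr_eq0 -dot_eq0 eq_le dot_ge0 andbT.
apply: le_trans (nearest_point_obtuse cC np Cc).
rewrite -[c - p](subrKA z) [leRHS]dotDr lerDr.
by apply: sumr_ge0 => i _; rewrite !mxE.
Qed.

Lemma isotone_proj_sublattice C : closed C -> convex_set C ->
  isotone (proj C) -> sublattice C.
Proof.
move=> clC cC iP x y Cx Cy.
have C0 : C !=set0 by exists x.
have Pfix c : C c -> proj C c = c.
  move=> Cc; apply: (@nearest_point_unique _ _ C c) => //.
    exact: proj_nearest.
  by split=> // q _; rewrite subrr enorm0 enorm_ge0.
split.
(* Isotonicity puts the projection of [z] below both [x] and [y], hence below [z]; so [z] lies
   between its projection and [x]. *)
- set z := cw_min x y.
  have zx : cw_le z x by move=> i; rewrite mxE ge_min lexx.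
  have zy : cw_le z y by move=> i; rewrite mxE ge_min lexx orbT.
  apply: (nearest_point_fixed cC (proj_nearest z clC C0) Cx) => i.
  apply: mulr_ge0; rewrite subr_ge0; last exact: zx.
  rewrite [leRHS]mxE le_min.
  by have := iP _ _ zx i; have := iP _ _ zy i;
    rewrite (Pfix _ Cx) (Pfix _ Cy) => -> ->.
- set z := cw_max x y.
  have xz : cw_le x z by move=> i; rewrite mxE le_max lexx.
  have yz : cw_le y z by move=> i; rewrite mxE le_max lexx orbT.
  apply: (nearest_point_fixed cC (proj_nearest z clC C0) Cx) => i.
  apply: mulr_le0; rewrite subr_le0; last exact: xz.
  rewrite [leLHS]mxE ge_max.
  by have := iP _ _ xz i; have := iP _ _ yz i;
    rewrite (Pfix _ Cx) (Pfix _ Cy) => -> ->.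
Qed.

Lemma dot_lt0_exists u v : dot u v < 0 -> exists k, u 0 k * v 0 k < 0.
Proof.
move=> uv; apply/not_existsP => h; suff : 0 <= dot u v by rewrite leNgt uv.
by apply: sumr_ge0 => i _; rewrite leNgt; apply/negP/h.
Qed.

(** If both products were negative, [u] would have a negative entry at some [k] in the support of
    [v] and at some [l] in that of [w]. Disjoint supports give [k != l], and then [u 0 k * u 0 l] is
    positive. *)
Lemma dot_ge0_or_disjoint u v w :
  (forall k l : 'I_m, k != l -> u 0 k * u 0 l <= 0) ->
  cw_le 0 v -> cw_le 0 w -> (forall k, v 0 k * w 0 k = 0) ->
  0 <= dot u v \/ 0 <= dot u w.
Proof.
move=> uP v0 w0 vw.
have [|/dot_lt0_exists[k uvk]] := leP 0 (dot u v); first by left.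
have [|/dot_lt0_exists[l uwl]] := leP 0 (dot u w); first by right.
move: (v0 k) (w0 l); rewrite !mxE => vk wl.
have uk : u 0 k < 0 by nra.
have ul : u 0 l < 0 by nra.
have kl : k != l.
  by apply/eqP => kl; rewrite kl in uvk; have := vw l; nra.
by have := uP _ _ kl; nra.
Qed.

Lemma halfspace_sublattice u a :
  (forall k l : 'I_m, k != l -> u 0 k * u 0 l <= 0) ->
  sublattice (halfspace u a).
Proof.
move=> uP x y; rewrite /halfspace /= => ux uy.
(* [v] and [w] are the positive and negative parts of [x - y]; the minimum and the maximum differ
   from [x] and from [y] by one of them. *)
pose v : 'rV[R]_m := \row_i Num.max (x 0 i - y 0 i) 0.
pose w : 'rV[R]_m := \row_i Num.max (y 0 i - x 0 i) 0.
have v0 : cw_le 0 v by move=> i; rewrite !mxE le_max lexx orbT.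
have w0 : cw_le 0 w by move=> i; rewrite !mxE le_max lexx orbT.
have vw k : v 0 k * w 0 k = 0.
  rewrite !mxE; case: (leP (x 0 k - y 0 k) 0) => h; first by rewrite mul0r.
  by rewrite [X in _ * X]max_r ?mulr0//; lra.
have minv : cw_min x y = x - v.
  by apply/rowP => i; rewrite !mxE; do 2 case: leP => ?; lra.
have minw : cw_min x y = y - w.
  by apply/rowP => i; rewrite !mxE; do 2 case: leP => ?; lra.
have maxv : cw_max x y = y + v.
  by apply/rowP => i; rewrite !mxE; do 2 case: leP => ?; lra.
have maxw : cw_max x y = x + w.
  by apply/rowP => i; rewrite !mxE; do 2 case: leP => ?; lra.
split.
  have [h|h] := dot_ge0_or_disjoint uP v0 w0 vw.
    by rewrite minv dotDr dotNr; lra.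
  by rewrite minw dotDr dotNr; lra.
(* The maximum adds [v] or [w] instead of subtracting it, so the dichotomy is applied to [- u],
   which satisfies the same sign condition. *)
have [|h|h] := @dot_ge0_or_disjoint (- u) v w _ v0 w0 vw.
- by move=> k l /uP; rewrite !mxE mulrNN.
- by rewrite maxv dotDr; move: h; rewrite dotNl; lra.
- by rewrite maxw dotDr; move: h; rewrite dotNl; lra.
Qed.

Lemma tangent_representation_sublattice C :
  tangent_representation C -> sublattice C.
Proof.
move=> [I [u [a [-> uP]]]] x y Cx Cy.
have uMm i (Ii : I i) : halfspace (u i) (a i) (cw_min x y) /\
    halfspace (u i) (a i) (cw_max x y).
  have [_ _ ui] := uP i Ii.
  by apply: halfspace_sublattice; [|exact: Cx|exact: Cy].
by split => i /uMm[].
Qed.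
End Sublattice.

(** * Balls inside [C] that touch its boundary *)

Section Tangent.
Variables (R : realType) (m : nat).
Implicit Types (x y z u v w p q c : 'rV[R]_m) (t : R) (C : set 'rV[R]_m).

(** The homothety with centre [c] and ratio [t] carries the ball of radius [e] about [p] to a ball
    of radius [t * e] about the combination. *)
Lemma convex_interior C p c t : convex_set C -> interior C p -> C c ->
  0 < t -> t <= 1 -> interior C (t *: p + (1 - t) *: c).
Proof.
move=> cC /nbhs_enormP[e e0 eC] Cc t0 t1; apply/nbhs_enormP.
exists (t * e) => [|w we]; first exact: mulr_gt0.
set d := t *: p + _ in we.
have -> : w = t *: (p + t^-1 *: (w - d)) + (1 - t) *: c.
  by apply/rowP => i; rewrite /d !mxE; field; rewrite gt_eqF.
apply: convex_comb => //; first exact: ltW.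
apply: eC; rewrite addrC addKr enormZ gtr0_norm ?invr_gt0//.
by rewrite -ltr_pdivlMl ?invr_gt0// invrK.
Qed.

Variables (C : set 'rV[R]_m) (x y : 'rV[R]_m).
Hypotheses (C_closed : closed C) (C_convex : convex_set C).
Hypotheses (Cy : interior C y) (xy : nearest_point (~` interior C) y x).

Lemma open_ball_interior w : enorm (w - y) < enorm (x - y) -> interior C w.
Proof.
move=> wy; apply: contrapT => /xy.2.
by rewrite leNgt enormBC [X in _ < X]enormBC wy.
Qed.

Lemma touching_point_neq_center : x - y != 0.
Proof.
by rewrite subr_eq0; apply/eqP => yx; apply: xy.1; rewrite yx.
Qed.

Lemma closed_ball_subset w : enorm (w - y) <= enorm (x - y) -> C w.
Proof.
move=> wy; apply: C_closed => B /nbhs_enormP[e e0 eB].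
set r := enorm (x - y) in wy.
have r0 : 0 < r by rewrite enorm_gt0 touching_point_neq_center.
(* Moving [w] by the fraction [s] towards [y] enters the open ball and displaces [w] by at most
   [s * r], hence by at most [e / 2]. *)
pose s := Num.min 1 (e / (2 * r)).
have s0 : 0 < s by rewrite lt_min ltr01 divr_gt0// mulr_gt0.
have s1 : s <= 1 by rewrite ge_min lexx.
have sr : s * (2 * r) <= e.
  by rewrite -ler_pdivlMr ?mulr_gt0// ge_min lexx orbT.
exists (w - s *: (w - y)); split.
  apply: interior_subset; apply: open_ball_interior.
  have -> : w - s *: (w - y) - y = (1 - s) *: (w - y).
    by apply/rowP => i; rewrite !mxE; ring.
  by rewrite enormZ ger0_norm ?subr_ge0// -/r; nra.
apply: eB; rewrite addrC addKr enormN enormZ gtr0_norm//; nra.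
Qed.

(** If [c] were beyond the hyperplane, the segment from [c] prolonged slightly past [x] would enter
    the open ball; [x] would then lie between an interior point and [c], so be interior. *)
Lemma touching_halfspace : C `<=` halfspace (x - y) x.
Proof.
move=> c Cc; rewrite /halfspace /= leNgt; apply/negP => b0.
have {}b0 : 0 < dot (x - y) (c - x) by rewrite dotDr dotNr subr_gt0.
set b := dot _ _ in b0; set q := dot (c - x) (c - x).
have q0 : 0 < q.
  by rewrite dot_gt0; apply: contraTneq b0 => cx; rewrite /b cx dot0r ltxx.
(* This [e] minimises the squared distance from [x - e *: (c - x)] to [y], lowering it by
   [e * b]. *)
pose e := b / q.
have e0 : 0 < e by rewrite divr_gt0.
have eq : e * q = b by rewrite divfK// gt_eqF.
have Cy' : interior C (x - e *: (c - x)).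
  apply: open_ball_interior; rewrite lt_enorm.
  have -> : x - e *: (c - x) - y = (x - y) - e *: (c - x).
    by apply/rowP => i; rewrite !mxE; ring.
  move: b0 eq; rewrite /b /q; move: (x - y) (c - x) => v w b0 eq.
  by rewrite !dotE (dotC w v); nra.
have e1 : 0 < 1 + e by rewrite addr_gt0.
apply: xy.1.
have -> : x = (1 + e)^-1 *: (x - e *: (c - x)) + (1 - (1 + e)^-1) *: c.
  by apply/rowP => i; rewrite !mxE; field; rewrite gt_eqF.
by apply: convex_interior; rewrite ?invr_gt0// invf_le1// lerDl ltW.
Qed.

Lemma touching_point_mem : C x.
Proof. exact: closed_ball_subset. Qed.

(** Another supporting normal [w] is rescaled to the length of [x - y]. As [y + k *: w] is in the
    ball, [dot (k *: w) (x - y)] is at least the squared radius: the equality case of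
    Cauchy-Schwarz, forcing [x - y = k *: w]. *)
Lemma touching_hyperplane_tangent : tangent C (hyperplane (x - y) x).
Proof.
have Cx := touching_point_mem.
exists x; split; first by split; [exact: subset_closure | exact: xy.1].
split.
  by split=> //; exists (x - y); split;
    [exact: touching_point_neq_center | by [] | exact: touching_halfspace].
move=> _ [_ [w [w0 -> Cw]]].
have r0 : 0 < enorm (x - y) by rewrite enorm_gt0 touching_point_neq_center.
have {}w0 : 0 < enorm w by rewrite enorm_gt0.
set r := enorm (x - y) in r0; pose k := r / enorm w.
have k0 : 0 < k by rewrite divr_gt0.
have vr : enorm (k *: w) = r.
  by rewrite enormZ gtr0_norm// divfK// gt_eqF.
have /Cw : C (y + k *: w).
  by apply: closed_ball_subset; rewrite addrC addKr vr.
rewrite /halfspace /= => wv.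
suff -> : x - y = k *: w.
  apply/seteqP; split => c; rewrite /hyperplane /= !dotZl; first by move->.
  by apply: mulfI; rewrite gt_eqF.
apply/eqP; rewrite -subr_eq0 -dot_eq0 eq_le dot_ge0 andbT.
have : dot (k *: w) (y + k *: w) <= dot (k *: w) x.
  by rewrite [leRHS]dotZl [leLHS]dotZl ler_pM2l.
have : dot (k *: w) (k *: w) = dot (x - y) (x - y).
  by rewrite -!sqr_enorm vr.
move: (k *: w) => v; rewrite !dotE !(dotC _ v) (dotC y x); lra.
Qed.

Lemma sublattice_touching_normal (k l : 'I_m) : sublattice C -> k != l ->
  (x - y) 0 k * (x - y) 0 l <= 0.
Proof.
move=> lC kl.
have u0 := touching_point_neq_center; have Cu := touching_halfspace.
have uC w : enorm w <= enorm (x - y) -> C (w + y).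
  by move=> wu; apply: closed_ball_subset; rewrite addrK.
have : x = (x - y) + y by rewrite subrK.
move: u0 Cu uC; set u := x - y; clearbody u => u0 Cu uC xE.
rewrite leNgt; apply/negP => P0.
set a := u 0 k in P0; set b := u 0 l in P0.
(* [t] maximises [2 * t * a * b - t ^+ 2 * d], the amount by which the lattice point built below
   overshoots the half-space; its value there is [t * a * b]. *)
pose d := a ^+ 2 + b ^+ 2; pose t := a * b / d; pose r2 := dot u u.
have d0 : 0 < d by rewrite /d; nra.
have t0 : 0 < t by rewrite divr_gt0.
have td : t * d = a * b by rewrite divfK// gt_eqF.
pose ek : 'rV[R]_m := delta_mx 0 k; pose el : 'rV[R]_m := delta_mx 0 l.
have r20 : 0 < r2 by rewrite dot_gt0.
(* The term f brings x + e and x - e back into the ball. *)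
pose e := t *: (b *: ek - a *: el).
pose g := t ^+ 2 * d; pose f := (g / r2) *: u.
have dr2 : d <= r2.
  rewrite /d /r2 /dot (bigD1 k)//= (bigD1 l)/=; last by rewrite eq_sym.
  rewrite addrA -!expr2 lerDl; apply: sumr_ge0 => i _.
  by rewrite -expr2 sqr_ge0.
have t1 : t <= 1 by rewrite ler_pdivrMr// mul1r /d; nra.
have g0 : 0 < g by rewrite mulr_gt0// exprn_gt0.
have gr2 : g <= r2 by apply: le_trans dr2; rewrite /g; nra.
have ue : dot u e = 0 by rewrite /e !dotE !dot_delta -/a -/b; ring.
have ee : dot e e = g.
  rewrite /e !dotE !dot_delta !mxE !eqxx.
  by rewrite (negbTE kl) eq_sym (negbTE kl) /= /g /d; ring.
have gg : g / r2 * r2 = g by rewrite divfK// gt_eqF.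
have g1 : g / r2 <= 1 by rewrite ler_pdivrMr ?mul1r.
have gr0 : 0 < g / r2 by rewrite divr_gt0.
have Ce (h : 'rV[R]_m) : dot u h = 0 -> dot h h = g -> C (x + h - f).
  move=> uh hh; have -> : x + h - f = (u + h - f) + y.
    by rewrite xE; apply/rowP => i; rewrite !mxE; ring.
  apply: uC; rewrite le_enorm /f !dotE !(dotC h u) uh hh -/r2.
  by nra.
have [Cm CM] := lC _ _ (Ce e ue ee) (Ce (- e) ltac:(by rewrite dotNr ue oppr0)
  ltac:(by rewrite dotNl dotNr opprK)).
(* As [a * b] is positive, [a] and [b] have the same sign: the maximum produces this point if they
   are positive, the minimum if they are negative. *)
have : C (x + t *: (b *: ek + a *: el) - f).
  have [a0|a0] := ltP 0 a.
    suff <- : cw_max (x + e - f) (x - e - f) = x + t *: (b *: ek + a *: el) - f.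
      by [].
    apply/rowP => i; rewrite !mxE /=; move: (_ * u 0 i) => fi.
    case: eqVneq => [->|ik] /=; first rewrite (negbTE kl) /=.
      by rewrite max_l; [ring | nra].
    case: eqVneq => [_|_] /=; first by rewrite max_r; [ring | nra].
    by rewrite max_l; [ring | lra].
  suff <- : cw_min (x + e - f) (x - e - f) = x + t *: (b *: ek + a *: el) - f.
    by [].
  apply/rowP => i; rewrite !mxE /=; move: (_ * u 0 i) => fi.
  case: eqVneq => [->|ik] /=; first rewrite (negbTE kl) /=.
    by rewrite min_l; [ring | nra].
  case: eqVneq => [_|_] /=; first by rewrite min_r; [ring | nra].
  by rewrite min_l; [ring | lra].
move=> /Cu; rewrite /halfspace /= /f !dotE !dot_delta -/a -/b -/r2.
by rewrite gg /g; nra.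
Qed.

End Tangent.

(** * Countably many touching half-spaces cut out [C] *)

Section Representation.
Variables (R : realType) (m : nat).
Implicit Types (x y z u v w p q c : 'rV[R]_m) (t : R) (C : set 'rV[R]_m).

Lemma nbhs_rat_row x (A : set 'rV[R]_m) :
  nbhs x A -> exists q : 'rV[rat]_m, A (map_mx ratr q).
Proof.
move=> /nbhs_ballP[e /= e0 eA].
have /choice[q qP] (i : 'I_m) : exists q : rat, `|x 0 i - ratr q| < e.
  have [|q] := @rat_in_itvoo R (x 0 i - e) (x 0 i + e); first lra.
  by rewrite in_itv/= => /andP[h1 h2]; exists q; rewrite ltr_norml; lra.
exists (\row_i q i); apply: eA; split => // i j.
by rewrite !mxE ord1; exact: qP.
Qed.

(** [s] is the supremum of the parameters whose points are interior. A neighbourhood of [z] outside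
    [C] gives [s < 1]; were the point at [s] interior, the parameter could be increased. *)
Lemma segment_exit_point C c z : closed C -> interior C c -> ~ C z ->
  exists s, [/\ 0 <= s, s < 1, ~ interior C (c + s *: (z - c)) &
    forall e, 0 < e ->
      exists2 p, interior C p & enorm (p - (c + s *: (z - c))) < e].
Proof.
move=> clC Cc Cz; pose b t := c + t *: (z - c).
have bB t t' : enorm (b t - b t') = `|t - t'| * enorm (z - c).
  by rewrite -enormZ; congr enorm; apply/rowP => i; rewrite !mxE; ring.
have b1 : b 1 = z by rewrite /b scale1r addrC subrK.
have zc : 0 < enorm (z - c).
  rewrite enorm_gt0 subr_eq0; apply/eqP => zc.
  by apply: Cz; rewrite zc; exact: interior_subset.
pose S := [set t | [/\ 0 <= t, t <= 1 & interior C (b t)]].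
have S0 : S 0 by split; rewrite ?ler01// /b scale0r addr0.
have ubS : has_ubound S by exists 1 => t [].
have supS : has_sup S by split => //; exists 0.
have s0 : 0 <= sup S by exact: ub_le_sup.
have s1 : sup S < 1.
  have /nbhs_enormP[e e0 eC] : nbhs z (~` C).
    by apply: open_nbhs_nbhs; split => //; exact: closed_openC.
  suff : sup S <= 1 - e / enorm (z - c).
    by move/le_lt_trans; apply; rewrite ltrBlDr ltrDl divr_gt0.
  apply: ge_sup => [|t [t0 t1 Ct]]; first by exists 0.
  rewrite lerBrDr -lerBrDl ler_pdivrMr// leNgt; apply/negP => te.
  apply: (eC (b t)); last exact: interior_subset.
  by rewrite -b1 bB ler0_norm ?subr_le0// opprB.
exists (sup S); split => //; rewrite -/(b (sup S)).
- move=> /nbhs_interior/nbhs_enormP[e e0 eC].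
  pose h := Num.min (1 - sup S) (e / 2 / enorm (z - c)).
  have h0 : 0 < h by rewrite lt_min subr_gt0 s1 !divr_gt0.
  have hs : h <= 1 - sup S by rewrite ge_min lexx.
  have he : h * enorm (z - c) <= e / 2.
    by rewrite -ler_pdivlMr// ge_min lexx orbT.
  have : sup S + h <= sup S.
    apply: ub_le_sup => //; split; [lra | lra |].
    by apply: eC; rewrite bB addrC addKr gtr0_norm//; lra.
  lra.
- move=> e e0; have ez : 0 < e / enorm (z - c) by rewrite divr_gt0.
  have [t St st] := sup_adherent ez supS.
  exists (b t); first by case: St.
  have := ub_le_sup ubS St; rewrite bB -ltr_pdivlMr// => ts.
  by rewrite ler0_norm ?subr_le0//; lra.
Qed.

Lemma touching_halfspace_excludes C z : closed C -> convex_set C ->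
  interior C !=set0 -> ~ C z ->
  exists q : 'rV[rat]_m, interior C (map_mx ratr q) /\
    forall x, nearest_point (~` interior C) (map_mx ratr q) x ->
      ~ halfspace (x - map_mx ratr q) x z.
Proof.
move=> clC cC [c Cc] Cz.
have [s [s0 s1]] := segment_exit_point clC Cc Cz.
set b := c + _ => Cb bC.
have /nbhs_enormP[e e0 eC] : nbhs c C by [].
(* If [z] were in the half-space, [b] being [(1 - s) *: c + s *: z] and [c] having depth at least
   [e / 2], [b] would have depth at least [(1 - s) * e / 2], that is [4 * h]; but [x] is within less
   than [4 * h] of [b]. *)
pose h := (1 - s) * e / 8.
have h0 : 0 < h by rewrite divr_gt0// mulr_gt0// subr_gt0.
have [p Cp pb] := bC h h0.
have : nbhs p (interior C `&` [set w | enorm (w - p) < h]).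
  apply: filterI; first exact: nbhs_interior.
  by apply/nbhs_enormP; exists h.
move=> /nbhs_rat_row[q [Cq qp]]; exists q; split => // x.
set y := map_mx ratr q in Cq qp *; rewrite /= in qp.
move=> xy; rewrite /halfspace /= => zx.
have yb : enorm (y - b) < 2 * h.
  have := ler_enormD (y - p) (p - b); rewrite subrKA; lra.
have xyb : enorm (x - y) <= enorm (y - b).
  by rewrite enormBC; exact: xy.2 Cb.
have u0 := touching_point_neq_center Cq xy.
have Cu := touching_halfspace cC xy.
set u := x - y in u0 Cu zx xyb.
have un0 : 0 < enorm u by rewrite enorm_gt0.
pose k := e / 2 / enorm u.
have k0 : 0 < k by rewrite !divr_gt0.
have ku : k * enorm u = e / 2 by rewrite divfK// gt_eqF.
have /Cu : C (c + k *: u).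
  by apply: eC; rewrite addrC addKr enormZ gtr0_norm// ku; lra.
rewrite /halfspace /= dotDr dotZr -sqr_enorm expr2 mulrA ku => uc.
have := dot_le_enorm u (x - b).
have : enorm (x - b) < 4 * h.
  by have := ler_enormD (x - y) (y - b); rewrite subrKA -/u; lra.
have -> : dot u (x - b) = dot u x - (1 - s) * dot u c - s * dot u z.
  by rewrite /b !dotE; ring.
rewrite /h; nra.
Qed.

Lemma sublattice_tangent_representation C : closed C -> convex_set C ->
  interior C !=set0 -> sublattice C -> tangent_representation C.
Proof.
move=> clC cC C0 lC.
(* Codes that decode to no rational vector give the centre 0, which is used only if it is
   interior. *)
pose y i : 'rV[R]_m := map_mx ratr (odflt (0 : 'rV[rat]_m) (unpickle i)).
(* The complement need not be convex; [proj] then just selects one nearest point. *)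
pose a i := proj (~` interior C) (y i).
(* The second condition empties [I] when [C = setT], where no touching point exists. *)
pose I := [set i | interior C (y i) /\ ~` interior C !=set0].
have aP i : I i -> nearest_point (~` interior C) (y i) (a i).
  move=> [_ ?]; apply: proj_nearest => //.
  by apply: open_closedC; exact: open_interior.
exists I, (fun i => a i - y i), a; split.
  apply/seteqP; split => [c Cc i Ii|z zI].
    exact: (touching_halfspace cC (aP i Ii) Cc).
  apply: contrapT => Cz.
  have [q [Cq qz]] := touching_halfspace_excludes clC cC C0 Cz.
  have yq : y (pickle q) = map_mx ratr q by rewrite /y pickleK.
  have Iq : I (pickle q).
    by split; [rewrite yq | exists z => /interior_subset].
  by apply: (qz (a (pickle q))); rewrite -yq; [exact: aP | exact: zI].
move=> i Ii; have nxy := aP i Ii; have Cy := Ii.1; split.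
- exact: touching_point_neq_center Cy nxy.
- exact: touching_hyperplane_tangent clC cC Cy nxy.
- move=> k l kl /=.
  exact: (sublattice_touching_normal clC cC Cy nxy lC kl).
Qed.

End Representation.

Theorem corollary4 (R : realType) (m : nat) (C : set 'rV[R]_m)
    (C_closed : closed C) (C_convex : convex_set C)
    (C_interior : interior C !=set0) :
  (sublattice C <-> isotone (proj C)) /\
  (isotone (proj C) <-> tangent_representation C).
Proof.
have C0 : C !=set0 by have [c /interior_subset] := C_interior; exists c.
have iso := sublattice_isotone_proj C_closed C_convex C0.
have sub := isotone_proj_sublattice C_closed C_convex.
split; split => //.
  by move=> /sub; exact: sublattice_tangent_representation.
by move=> tC; apply: iso; exact: tangent_representation_sublattice tC.
Qed.
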